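(* Let $\mathcal A\in\mathbb C^{n_1\times n_2\times n_3}$, $\mathcal X^\star\in\mathbb C^{n_2\times n_4\times n_3}$, $\mathcal B\in\mathbb C^{n_1\times n_4\times n_3}$ satisfy $\mathcal A\mathcal X^\star=\mathcal B$ (t-product), let $\mathcal E_A\in\mathbb C^{n_1\times n_2\times n_3}$, $\mathcal E_B\in\mathbb C^{n_1\times n_4\times n_3}$ be fixed perturbation tensors, and put $\tilde{\mathcal A}=\mathcal A+\mathcal E_A$, $\tilde{\mathcal B}=\mathcal B+\mathcal E_B$. Let $$\mathcal I_+:=\{i\in[n_1]:\|\tilde{\mathcal A}_{i::}\|_F>0\}.$$ Assume that $\tilde{\mathcal A}_{i::}\tilde{\mathcal A}_{i::}^*$ is invertible (as a $1\times1\times n_3$ tensor under the t-product) for every row index $i$ that can be used in the iteration, i.e. every $i\in\mathcal I_+$, and that the block-circulant matrix $\operatorname{bcirc}(\tilde{\mathcal A})$ has full column rank. For each $i\in\mathcal I_+$ define $$\gamma_i=\frac{\max_{1\le \ell\le n_3}\|\hat{\tilde A}_{i:}^{(\ell)}\|_F^2}{\min_{1\le \ell\le n_3}\|\hat{\tilde A}_{i:}^{(\ell)}\|_F^2},\qquad \gamma=\max_{i\in\mathcal I_+}\gamma_i .$$ Let $(\mathcal X^t)_{t\ge0}$ be the tensor randomized Kaczmarz (TRK) iterates for the observed system $\tilde{\mathcal A}\mathcal X=\tilde{\mathcal B}$, $$\mathcal X^{t+1}=\mathcal X^t-\tilde{\mathcal A}_{i_t::}^*\left(\tilde{\mathcal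 A}_{i_t::}\tilde{\mathcal A}_{i_t::}^*\right)^{-1}\left(\tilde{\mathcal A}_{i_t::}\mathcal X^t-\tilde{\mathcal B}_{i_t::}\right),$$ where $i_t$ is sampled independently at each iteration $t$ according to the distribution $p_i=\|\tilde{\mathcal A}_{i::}\|_F^2/\|\tilde{\mathcal A}\|_F^2$, $i\in[n_1]$, and let $\mathcal E^t:=\mathcal X^t-\mathcal X^\star$. Then for every $t\ge 0$, $$\mathbb E\left[\|\mathcal E^{t+1}\|_F^2\right]\le\left(1-\frac{\sigma_{\min}^2(\operatorname{bcirc}(\tilde{\mathcal A}))}{n_3\|\tilde{\mathcal A}\|_F^2}\right)\mathbb E\left[\|\mathcal E^t\|_F^2\right]+\frac{\gamma\,\|\mathcal E_A\mathcal X^\star-\mathcal E_B\|_F^2}{\|\tilde{\mathcal A}\|_F^2}.$$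
   Context: Notation. $[m]=\{1,\dots,m\}$. For a third-order tensor $\mathcal A\in\mathbb C^{n_1\times n_2\times n_3}$: $\mathcal A_{i::}\in\mathbb C^{1\times n_2\times n_3}$ is its $i$-th horizontal (row) slice, $\mathcal A_{::k}$ its $k$-th frontal slice, and $\|\mathcal A\|_F=(\sum_{i,j,k}|\mathcal A_{ijk}|^2)^{1/2}$. For a matrix, $\sigma_{\min}$ denotes the smallest singular value, and $\|\cdot\|_F$ the Frobenius norm. t-product. With $A^{(k)}=\mathcal A_{::k}$, $\operatorname{bcirc}(\mathcal A)\in\mathbb C^{n_1n_3\times n_2n_3}$ is the block-circulant matrix whose $(p,q)$ block ($p,q\in[n_3]$) is $A^{(r)}$ with $r\in[n_3]$, $r\equiv p-q+1 \pmod{n_3}$ (so the first block column is $A^{(1)},\dots,A^{(n_3)}$ from top to bottom). $\operatorname{unfold}(\mathcal A)$ stacks the frontal slices $\mathcal A_{::1},\dots,\mathcal A_{::n_3}$ vertically, and $\operatorname{fold}$ is its inverse. The t-product of $\mathcal A\in\mathbb C^{n_1\times n_2\times n_3}$ and $\mathcal B\in\mathbb C^{n_2\times n_4\times n_3}$ is $\mathcal A\mathcal B=\operatorname{fold}(\operatorname{bcirc}(\mathcal A)\operatorname{unfold}(\mathcal B))\in\mathbb C^{n_1\times n_4\times n_3}$; all products of tensors are t-products. The identity tensor $\mathcal I$ of size $n\times n\times n_3$ has first frontal slice equal to the $n\times n$ identity matrix and all other entries zero. The conjugate transpose $\mathcal A^*$ is obtained by taking the conjugate transpose of every frontal slice and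 reversing the order of frontal slices $2,\dots,n_3$. A tensor $\mathcal A$ is invertible if there is $\mathcal A^{-1}$ with $\mathcal A\mathcal A^{-1}=\mathcal A^{-1}\mathcal A=\mathcal I$. Fourier notation. $\hat{\mathcal A}$ is the (unnormalized) discrete Fourier transform of length $n_3$ applied to every tube along the third dimension, i.e. its $k$-th frontal slice is $\hat A^{(k)}=\sum_{j=1}^{n_3}e^{-2\pi \mathrm i (j-1)(k-1)/n_3}\mathcal A_{::j}$. $\hat{\tilde A}_{i:}^{(k)}$ denotes the $i$-th row of the $k$-th frontal slice of the transform of $\tilde{\mathcal A}$. The invertibility assumption guarantees that $\hat{\tilde A}_{i:}^{(\ell)}\neq0$ for all $i\in\mathcal I_+$ and all $\ell$, so $\gamma_i$ is well-defined. The initial iterate $\mathcal X^0\in\mathbb C^{n_2\times n_4\times n_3}$ is a given tensor, and $\mathbb E[\cdot]$ denotes expectation with respect to the randomized row selection. *)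

(* Defs.v *)
From mathcomp Require Import all_boot all_order all_algebra.
From mathcomp Require Import complex.
From mathcomp Require Import all_classical all_reals all_analysis.

Set Implicit Arguments.
Unset Strict Implicit.
Unset Printing Implicit Defensive.

Import Order.TTheory GRing.Theory Num.Theory.
Local Open Scope ring_scope.
Local Open Scope classical_set_scope.
Local Open Scope sesquilinear_scope.

(* A third-order tensor is the family of its frontal slices: [A k i j] is the
   entry in row i, column j of frontal slice k.  All indices start at 0, so the
   first frontal slice is [A 0].  The third dimension is [n.+1], which makes the
   slice index type 'I_n.+1 the additive group Z/(n+1): below, [p - q] and [- k]
   on slice indices are taken modulo n+1. *)
Notation tensor R n1 n2 n := {ffun 'I_n.+1 -> 'M[R[i]]_(n1, n2)}.

Section Tensors.
Variable R : realType.
Local Notation C := R[i].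

Definition mxnorm m n (M : 'M[C]_(m, n)) : R :=
  Num.sqrt (\sum_i \sum_j Normc.normc (M i j) ^+ 2).

Definition tnorm n1 n2 n (A : tensor R n1 n2 n) : R :=
  Num.sqrt (\sum_(k < n.+1) \sum_i \sum_j Normc.normc (A k i j) ^+ 2).

Definition hslice n1 n2 n (A : tensor R n1 n2 n) (i : 'I_n1) : tensor R 1 n2 n :=
  [ffun k : 'I_n.+1 => row i (A k)].

Definition bcirc n1 n2 n (A : tensor R n1 n2 n) :
    'M[C]_(\sum_(p < n.+1) n1, \sum_(q < n.+1) n2) :=
  \mxblock_(p < n.+1, q < n.+1) A (p - q).

Definition unfold n1 n2 n (A : tensor R n1 n2 n) :
    'M[C]_(\sum_(p < n.+1) n1, n2) :=
  \mxcol_(p < n.+1) A p.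

Definition fold n1 n2 n (M : 'M[C]_(\sum_(p < n.+1) n1, n2)) :
    tensor R n1 n2 n :=
  [ffun p : 'I_n.+1 => submxcol M p].

Definition tmul n1 n2 n4 n (A : tensor R n1 n2 n) (B : tensor R n2 n4 n) :
    tensor R n1 n4 n :=
  fold (bcirc A *m unfold B).

Definition tid m n : tensor R m m n :=
  [ffun k : 'I_n.+1 => if k == 0 then 1%:M else 0].

Definition tadj n1 n2 n (A : tensor R n1 n2 n) : tensor R n2 n1 n :=
  [ffun k : 'I_n.+1 => (A (- k)) ^t*].

Definition is_tinv m n (A B : tensor R m m n) : Prop :=
  tmul A B = tid m n /\ tmul B A = tid m n.

Definition tinvertible m n (A : tensor R m m n) : Prop :=
  exists B, is_tinv A B.

(* The inverse, with junk value 0 on non-invertible tensors. *)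
Definition tinv m n (A : tensor R m m n) : tensor R m m n :=
  match pselect (tinvertible A) with
  | left invA => projT1 (cid invA)
  | right _ => 0
  end.

Definition cis (x : R) : C := (cos x +i* sin x)%C.

Definition dft n1 n2 n (A : tensor R n1 n2 n) : tensor R n1 n2 n :=
  [ffun k : 'I_n.+1 => \sum_(j < n.+1)
     cis (- (2 * pi * j%:R * k%:R / n.+1%:R)) *: A j].

(* The pair (u, v) consists of a left and a right singular vector for s.  Both
   relations are required, so an m x n matrix has min(m, n) singular values
   (with multiplicity); in particular 0 is not a singular value of a tall
   matrix of full column rank. *)
Definition singular_value m n (M : 'M[C]_(m, n)) (s : R) : Prop :=
  0 <= s /\
  exists (u : 'cV[C]_m) (v : 'cV[C]_n),
    [/\ mxnorm u = 1, mxnorm v = 1,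
        M *m v = (s%:C)%C *: u & M ^t* *m u = (s%:C)%C *: v].

(* The set of singular values is finite, so the infimum is its least element. *)
Definition sigma_min m n (M : 'M[C]_(m, n)) : R := inf (singular_value M).

Definition Iplus n1 n2 n (A : tensor R n1 n2 n) : {set 'I_n1} :=
  [set i | 0 < tnorm (hslice A i)]%SET.

Definition hatrow_sq n1 n2 n (A : tensor R n1 n2 n) (i : 'I_n1) (l : 'I_n.+1) : R :=
  mxnorm (row i (dft A l)) ^+ 2.

(* Index sets of the next two extrema are nonempty, so starting from the value
   at index 0 does not change them. *)
Definition gamma_row n1 n2 n (A : tensor R n1 n2 n) (i : 'I_n1) : R :=
  \big[Num.max/hatrow_sq A i 0]_(l < n.+1) hatrow_sq A i l /
  \big[Num.min/hatrow_sq A i 0]_(l < n.+1) hatrow_sq A i l.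

(* All gamma_row are nonnegative, so 0 is neutral. *)
Definition gamma n1 n2 n (A : tensor R n1 n2 n) : R :=
  \big[Num.max/0]_(i in Iplus A) gamma_row A i.

Definition row_prob n1 n2 n (A : tensor R n1 n2 n) (i : 'I_n1) : R :=
  tnorm (hslice A i) ^+ 2 / tnorm A ^+ 2.

Definition trk_step n1 n2 n4 n (A : tensor R n1 n2 n) (B : tensor R n1 n4 n)
    (i : 'I_n1) (X : tensor R n2 n4 n) : tensor R n2 n4 n :=
  let Ai := hslice A i in
  X - tmul (tmul (tadj Ai) (tinv (tmul Ai (tadj Ai))))
           (tmul Ai X - hslice B i).

Fixpoint trk n1 n2 n4 n (A : tensor R n1 n2 n) (B : tensor R n1 n4 n)
    (X0 : tensor R n2 n4 n) (idx : nat -> 'I_n1) (t : nat) : tensor R n2 n4 n :=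
  if t is s.+1 then trk_step A B (idx s) (trk A B X0 idx s) else X0.

(* Mutual independence of a sequence of random variables with values in a finite
   type carrying the discrete sigma-algebra: the product rule over every finite
   set of times (a duplicate-free sequence) and all events. *)
Definition mutually_independent d (T : measurableType d) (P : probability T R)
    (I : finType) (X : nat -> T -> I) : Prop :=
  forall (s : seq nat) (S : nat -> set I), uniq s ->
    P (\bigcap_(t in [set` s]) (X t @^-1` S t)) =
    (\prod_(t <- s) P (X t @^-1` S t))%E.

(* X is an i.i.d. sequence of random elements of I with mass function p. *)
Definition iid_with_law d (T : measurableType d) (P : probability T R)
    (I : finType) (p : I -> R) (X : nat -> T -> I) : Prop :=
  [/\ forall t x, measurable (X t @^-1` [set x]),
      forall t x, P (X t @^-1` [set x]) = (p x)%:E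
    & mutually_independent P X].

End Tensors.

(* Main.v *)
Require Import Defs.
From mathcomp Require Import all_boot all_order all_algebra.
From mathcomp Require Import complex ring lra.
From mathcomp Require Import all_classical all_reals all_analysis.
From mathcomp Require Import measurable_realfun.

(** The discrete Fourier transform along the third dimension turns the t-product
    into independent matrix products, one per frequency ([dft_tmul]), turns the
    conjugate transpose into the conjugate transpose ([dft_tadj]), and multiplies
    squared norms by [n.+1] ([parseval]).  At frequency [k] the transformed row
    slice is an ordinary row vector [a]; invertibility of the 1 x 1 tensor
    forces [a] to be nonzero, and one Kaczmarz step is the map
    [E |-> E - a^* (a E + r) / |a|^2] on the error, where [r] is the transformed
    row of the residual of the exact solution.  The part [E - a^* a E / |a|^2] is
    orthogonal to the range of [a^*], so Pythagoras gives the exact identity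
    [|E'|^2 = |E|^2 - |a E|^2 / |a|^2 + |r|^2 / |a|^2] ([fnorm_sq_kaczmarz]).

    In the mean over the rows, the weight [p_i = |A_i|^2 / |A|^2] equals
    [(\sum_l |a_il|^2) / (n3 |A|^2)] with [n3 = n.+1], so for a nonzero row
    [p_i / |a_ik|^2] lies between
    [1 / (n3 |A|^2)] (keep the single term [l = k]) and [gamma / |A|^2] (bound
    every term by the largest ratio).  Transforming back, the mean decrease is at
    least [|A E|^2 / (n3 |A|^2)] and the mean increase at most
    [gamma |r|^2 / |A|^2] ([trk_step_error_mean]).  Since
    [unfold (A E) = bcirc A *m unfold E], the smallest singular value of [bcirc A]
    bounds [|A E|] from below ([sigma_min_le]).  That bound comes from
    diagonalising [M^* M] in a unitary basis: its least eigenvalue is the square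
    of a singular value because full column rank makes it positive.

    On the probabilistic side the iterate at time [t] is a function of the first
    [t] indices, which take finitely many values, so every expectation is a
    finite sum over index histories weighted by products of the [p_i]; the
    one-step inequality, valid for each history, is averaged over these
    ([iid_mean_recursion]). *)

Import Order.TTheory GRing.Theory Num.Theory.
Local Open Scope ring_scope.

Set Implicit Arguments.
Unset Strict Implicit.
Unset Printing Implicit Defensive.

(** * Squared Frobenius norm *)

Section FrobeniusSquare.
Local Open Scope sesquilinear_scope.
Context {R : realType}.
Local Notation C := R[i].
Local Notation "x %:C" := (real_complex R x).

Definition fnorm_sq m n (M : 'M[C]_(m, n)) : R :=
  \sum_i \sum_j Normc.normc (M i j) ^+ 2.

Lemma fnorm_sq_ge0 m n (M : 'M[C]_(m, n)) : 0 <= fnorm_sq M.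
Proof. by apply: sumr_ge0 => i _; apply: sumr_ge0 => j _; apply: sqr_ge0. Qed.

Lemma normc_sqrE (x : C) : (Normc.normc x ^+ 2)%:C = x^* * x.
Proof. by rewrite mulrC -normCK rmorphXn. Qed.

Lemma mxnorm_sqr m n (M : 'M[C]_(m, n)) : mxnorm M ^+ 2 = fnorm_sq M.
Proof. by rewrite sqr_sqrtr ?fnorm_sq_ge0. Qed.

Lemma tnorm_sqr n1 n2 n (A : tensor R n1 n2 n) :
  tnorm A ^+ 2 = \sum_k fnorm_sq (A k).
Proof.
by rewrite sqr_sqrtr //; apply: sumr_ge0 => k _; apply: fnorm_sq_ge0.
Qed.

Lemma fnorm_sq_tr m n (M : 'M[C]_(m, n)) : (fnorm_sq M)%:C = \tr (M ^t* *m M).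
Proof.
rewrite /fnorm_sq exchange_big rmorph_sum /=; apply: eq_bigr => j _.
rewrite rmorph_sum /= !mxE; apply: eq_bigr => i _.
by rewrite normc_sqrE !mxE.
Qed.

Lemma fnorm_sq_adj m n (M : 'M[C]_(m, n)) : fnorm_sq (M ^t*) = fnorm_sq M.
Proof. by apply: complexI; rewrite !fnorm_sq_tr trmxCK mxtrace_mulC. Qed.

Lemma adjM m n p (M : 'M[C]_(m, n)) (N : 'M[C]_(n, p)) :
  (M *m N) ^t* = N ^t* *m M ^t*.
Proof. by rewrite trmx_mul map_mxM. Qed.

Lemma adjZ m n (c : R) (M : 'M[C]_(m, n)) : (c%:C *: M) ^t* = c%:C *: M ^t*.
Proof.
by apply/matrixP => i j; rewrite !mxE rmorphM; congr (_ * _); apply: conjc_real.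
Qed.

Lemma adjD m n (M N : 'M[C]_(m, n)) : (M + N) ^t* = M ^t* + N ^t*.
Proof. by apply/matrixP => i j; rewrite !mxE rmorphD. Qed.

Lemma adjB m n (M N : 'M[C]_(m, n)) : (M - N) ^t* = M ^t* - N ^t*.
Proof. by apply/matrixP => i j; rewrite !mxE rmorphB. Qed.

Lemma fnorm_sq_eq0 m n (M : 'M[C]_(m, n)) : (fnorm_sq M == 0) = (M == 0).
Proof.
apply/eqP/eqP => [M0|->]; last first.
  by apply: complexI; rewrite fnorm_sq_tr mulmx0 mxtrace0.
apply/matrixP => i j; rewrite mxE; apply: Normc.eq0_normc; apply/eqP.
have inner_ge0 l : 0 <= \sum_j Normc.normc (M l j) ^+ 2.
  by apply: sumr_ge0 => k _; apply: sqr_ge0.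
move/eqP: M0; rewrite psumr_eq0 // => /allP /(_ i (mem_index_enum i)) /=.
rewrite psumr_eq0; last by move=> k _; apply: sqr_ge0.
by move=> /allP /(_ j (mem_index_enum j)) /=; rewrite sqrf_eq0.
Qed.

Lemma fnorm_sq_scale m n (c : R) (M : 'M[C]_(m, n)) :
  fnorm_sq (c%:C *: M) = c ^+ 2 * fnorm_sq M.
Proof.
apply: complexI; rewrite rmorphM /= !fnorm_sq_tr adjZ.
by rewrite -scalemxAl -scalemxAr scalerA linearZ /= expr2 rmorphM.
Qed.

Lemma fnorm_sq_rows m n (M : 'M[C]_(m, n)) : fnorm_sq M = \sum_i fnorm_sq (row i M).
Proof.
apply: eq_bigr => i _; rewrite /fnorm_sq big_ord1.
by apply: eq_bigr => j _; rewrite mxE.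
Qed.

Lemma fnorm_sq_unitary m n (U : 'M[C]_m) (M : 'M[C]_(m, n)) :
  U \is unitarymx -> fnorm_sq (U *m M) = fnorm_sq M.
Proof.
rewrite -trmxC_unitary => /unitarymxP; rewrite trmxCK => UU.
by apply: complexI; rewrite !fnorm_sq_tr adjM mulmxA -(mulmxA (M ^t*)) UU mulmx1.
Qed.

Lemma trace_diag_form m n (d : 'rV[R]_m) (Y : 'M[C]_(m, n)) :
  \tr (Y ^t* *m diag_mx (map_mx (real_complex R) d) *m Y) =
  (\sum_j d 0 j * fnorm_sq (row j Y))%:C.
Proof.
rewrite -mulmxA mxtrace_mulC rmorph_sum /=; apply: eq_bigr => j _.
rewrite rmorphM /fnorm_sq big_ord1 rmorph_sum /= mulr_sumr mxE.
apply: eq_bigr => k _; rewrite normc_sqrE mul_diag_mx !mxE.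
ring.
Qed.

End FrobeniusSquare.

(** * The smallest singular value *)

Section SingularValues.
Local Open Scope sesquilinear_scope.
Context {R : realType}.
Local Notation C := R[i].
Local Notation "x %:C" := (real_complex R x).

(** In a unitary basis diagonalising [M^* M], the quadratic form [|M X|^2] is a
    combination of the squared rows of [X] with weights [|M v_j|^2], so the least
    weight bounds it below.  That weight is the square of a singular value with
    left vector [M v_j / s]; full column rank gives [s > 0]. *)
Lemma least_singular_value m n (M : 'M[C]_(m, n)) : (0 < n)%N -> \rank M = n ->
  exists2 s : R, singular_value M s &
    forall p (X : 'M[C]_(n, p)), s ^+ 2 * fnorm_sq X <= fnorm_sq (M *m X).
Proof.
move=> n_gt0 rkM; pose H := M ^t* *m M.
have HH : H \is hermsymmx.
  by apply/is_hermitianmxP; rewrite expr0 scale1r adjM trmxCK.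
have := orthomx_spectralP (hermitian_normalmx HH).
have := spectral_unitarymx H; set U := spectralmx H; set D := spectral_diag H.
move=> Uu; rewrite invmx_unitary // => HE.
have UU : U *m U ^t* = 1%:M by apply/unitarymxP.
pose v j := col j (U ^t*).
(* The eigenvalues, in the form that shows that they are real and nonnegative. *)
pose dl : 'rV[R]_n := \row_j fnorm_sq (M *m v j).
have Hv j : H *m v j = D 0 j *: v j.
  rewrite /v !colE mulmxA {1}HE -!(mulmxA _ U) UU mulmx1 -!colE mul_mx_diag.
  by apply/matrixP => a b; rewrite !mxE mulrC.
have v1 j : fnorm_sq (v j) = 1.
  apply: complexI; rewrite fnorm_sq_tr /mxtrace big_ord1.
  transitivity ((U *m U ^t*) j j); last by rewrite UU mxE eqxx.
  by rewrite mxE [RHS]mxE; apply: eq_bigr => k _; rewrite !mxE conjCK.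
have DE : D = map_mx (real_complex R) dl.
  apply/rowP => j; rewrite !mxE fnorm_sq_tr adjM mulmxA -(mulmxA _ _ M) -/H.
  by rewrite -mulmxA Hv -scalemxAr linearZ /= -fnorm_sq_tr v1 mulr1.
have lower p (X : 'M[C]_(n, p)) :
    fnorm_sq (M *m X) = \sum_j dl 0 j * fnorm_sq (row j (U *m X)).
  apply: complexI; rewrite -trace_diag_form -DE fnorm_sq_tr !adjM.
  rewrite mulmxA [in LHS]mulmxA -(mulmxA _ _ M) -/H.
  by rewrite HE !mulmxA.
have [j0 _ j0_min] := @arg_minP _ _ _ (Ordinal n_gt0) predT (dl 0) isT.
have v_neq0 : v j0 != 0 by rewrite -fnorm_sq_eq0 v1 oner_eq0.
have dl_gt0 : 0 < dl 0 j0.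
  rewrite mxE lt_neqAle fnorm_sq_ge0 andbT eq_sym fnorm_sq_eq0.
  apply: contra v_neq0 => /eqP /(congr1 trmx); rewrite trmx_mul trmx0.
  move=> /eqP; rewrite mulmx_free_eq0; last by rewrite /row_free mxrank_tr rkM.
  by move=> /eqP /(congr1 trmx); rewrite trmxK trmx0 => ->.
exists (Num.sqrt (dl 0 j0)) => [|p X]; last first.
  rewrite sqr_sqrtr ?(ltW dl_gt0) // -(fnorm_sq_unitary X Uu) lower fnorm_sq_rows.
  rewrite mulr_sumr.
  by apply: ler_sum => j _; rewrite ler_wpM2r ?fnorm_sq_ge0 ?j0_min.
set s := Num.sqrt _; have s_gt0 : 0 < s by rewrite sqrtr_gt0.
have sqs : s ^+ 2 = dl 0 j0 by rewrite sqr_sqrtr // ltW.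
split; first exact: ltW.
exists ((s^-1)%:C *: (M *m v j0)), (v j0); split.
- apply/eqP; rewrite -sqrp_eq1 ?sqrtr_ge0 // mxnorm_sqr fnorm_sq_scale exprVn sqs.
  by move: dl_gt0; rewrite mxE => /gt_eqF dl0; rewrite mulVf ?dl0.
- by apply/eqP; rewrite -sqrp_eq1 ?sqrtr_ge0 // mxnorm_sqr v1.
- by rewrite scalerA -rmorphM mulfV ?gt_eqF // scale1r.
- rewrite -scalemxAr mulmxA -/H Hv scalerA DE mxE -sqs -rmorphM.
  by rewrite expr2 mulKf // gt_eqF.
Qed.

(** The infimum defining [sigma_min] is at most the singular value that realises
    the bound, and it is nonnegative, so it may be squared. *)
Lemma sigma_min_le m n p (M : 'M[C]_(m, n)) (X : 'M[C]_(n, p)) :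
  (0 < n)%N -> \rank M = n -> sigma_min M ^+ 2 * fnorm_sq X <= fnorm_sq (M *m X).
Proof.
move=> n_gt0 rkM; have [s sv_s sX] := least_singular_value n_gt0 rkM.
have lb0 : lbound (singular_value M) 0 by move=> r [].
apply: le_trans (sX _ X); rewrite ler_wpM2r ?fnorm_sq_ge0 //.
have s0 : 0 <= s by case: sv_s.
rewrite ler_sqr ?nnegrE //; last by apply: lb_le_inf => //; exists s.
by apply: ge_inf => //; exists 0.
Qed.

End SingularValues.

(** * One Kaczmarz projection on matrices *)

Section Projection.
Local Open Scope sesquilinear_scope.
Context {R : realType}.
Local Notation C := R[i].
Local Notation "x %:C" := (real_complex R x).

(** Expanding [|E - w a^* (a E + r)|^2] with [w = 1 / |a|^2], all the terms that
    mix [a E] and [r] cancel: the correction due to [r] is orthogonal to what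
    the projection leaves of [E].  The hypothesis is the form in which the
    invertibility of the row's Gram tensor reaches a single frequency. *)
Lemma fnorm_sq_kaczmarz n p (a : 'rV[C]_n) (g : 'M[C]_1)
    (E : 'M[C]_(n, p)) (r : 'rV[C]_p) :
  g *m (a *m a ^t*) = 1%:M ->
  0 < fnorm_sq a /\
  fnorm_sq (E - a ^t* *m g *m (a *m E + r)) =
    fnorm_sq E - (fnorm_sq (a *m E) - fnorm_sq r) / fnorm_sq a.
Proof.
move=> ga1.
have aa : a *m a ^t* = ((fnorm_sq a)%:C)%:M.
  rewrite [LHS]mx11_scalar; congr (_%:M).
  by rewrite -fnorm_sq_adj fnorm_sq_tr trmxCK /mxtrace big_ord1.
have a_neq0 : fnorm_sq a != 0.
  apply/eqP => a0; move: ga1; rewrite aa a0 mul_mx_scalar.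
  by move=> /matrixP /(_ 0 0); rewrite !mxE mul0r => /esym /eqP; rewrite oner_eq0.
split; first by rewrite lt_neqAle eq_sym a_neq0 fnorm_sq_ge0.
set w := (fnorm_sq a)^-1.
have -> : g = (w%:C)%:M.
  have aC : (fnorm_sq a)%:C != 0 by rewrite fmorph_eq0.
  move: ga1; rewrite aa mul_mx_scalar => /(congr1 ( *:%R (w%:C))).
  by rewrite scalerA -rmorphM mulVf // scale1r scalemx1.
rewrite mul_mx_scalar -scalemxAl; set F := a *m E; set Q := F + r.
apply: complexI; rewrite rmorphB rmorphM rmorphB /= !fnorm_sq_tr -/w.
rewrite adjB adjZ adjM trmxCK.
rewrite mulmxBl !mulmxBr -!scalemxAl -!scalemxAr !scalerA !mulmxA.
rewrite -(mulmxA (Q ^t*) a (a ^t*)) aa mul_mx_scalar -scalemxAl.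
have -> : E ^t* *m a ^t* = F ^t* by rewrite adjM.
have wwa : w%:C * w%:C * (fnorm_sq a)%:C = w%:C.
  by rewrite -!rmorphM /= -mulrA mulVf ?mulr1.
rewrite scalerA wwa -!(mulmxA _ a) -/F /Q adjD !mulmxDl !mulmxDr.
rewrite !(raddfB, raddfD) /= !mxtraceZ; ring.
Qed.

End Projection.

(** * The t-product and block-circulant matrices *)

Section TProduct.
Local Open Scope sesquilinear_scope.
Context {R : realType}.

Lemma taddE n1 n2 n (A B : tensor R n1 n2 n) k : (A + B) k = A k + B k.
Proof. by rewrite ffunE. Qed.

Lemma tsubE n1 n2 n (A B : tensor R n1 n2 n) k : (A - B) k = A k - B k.
Proof. by rewrite !ffunE. Qed.

Lemma tmulE n1 n2 n4 n (A : tensor R n1 n2 n) (B : tensor R n2 n4 n) p :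
  tmul A B p = \sum_q A (p - q) *m B q.
Proof.
by rewrite ffunE /bcirc /unfold mul_mxblock_mxrow mxcolK.
Qed.

Lemma fnorm_sq_unfold n1 n2 n (A : tensor R n1 n2 n) :
  fnorm_sq (unfold A) = tnorm A ^+ 2.
Proof.
have adj_unfold : (unfold A) ^t* = \mxrow_k (A k) ^t*.
  by apply/matrixP => a b; rewrite !mxE.
apply: complexI; rewrite fnorm_sq_tr adj_unfold mul_mxrow_mxcol.
rewrite tnorm_sqr rmorph_sum raddf_sum; apply: eq_bigr => k _ /=.
by rewrite fnorm_sq_tr.
Qed.

(** Lets the singular values of [bcirc A] control the norm of a t-product. *)
Lemma bcirc_unfold n1 n2 n4 n (A : tensor R n1 n2 n) (B : tensor R n2 n4 n) :
  bcirc A *m unfold B = unfold (tmul A B).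
Proof.
rewrite -[LHS]submxcolK; apply: eq_mxcol => p; by rewrite ffunE.
Qed.

Lemma hslice_tmul n1 n2 n4 n (A : tensor R n1 n2 n) (B : tensor R n2 n4 n) i :
  hslice (tmul A B) i = tmul (hslice A i) B.
Proof.
apply/ffunP => p; rewrite ffunE !tmulE raddf_sum; apply: eq_bigr => q _ /=.
by rewrite row_mul ffunE.
Qed.

Lemma hslice_sub n1 n2 n (A B : tensor R n1 n2 n) i :
  hslice (A - B) i = hslice A i - hslice B i.
Proof. by apply/ffunP => p; rewrite !ffunE raddfB. Qed.

Lemma tmulDl n1 n2 n4 n (A A' : tensor R n1 n2 n) (B : tensor R n2 n4 n) :
  tmul (A + A') B = tmul A B + tmul A' B.
Proof.
apply/ffunP => p; rewrite taddE !tmulE -big_split; apply: eq_bigr => q _ /=.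
by rewrite taddE mulmxDl.
Qed.

Lemma tmulBr n1 n2 n4 n (A : tensor R n1 n2 n) (B B' : tensor R n2 n4 n) :
  tmul A (B - B') = tmul A B - tmul A B'.
Proof.
apply/ffunP => p; rewrite tsubE !tmulE -sumrB; apply: eq_bigr => q _ /=.
by rewrite tsubE mulmxBr.
Qed.

Lemma tnorm_rows n1 n2 n (A : tensor R n1 n2 n) :
  tnorm A ^+ 2 = \sum_i tnorm (hslice A i) ^+ 2.
Proof.
rewrite tnorm_sqr (eq_bigr _ (fun k _ => fnorm_sq_rows (A k))) exchange_big /=.
apply: eq_bigr => i _; rewrite tnorm_sqr; apply: eq_bigr => k _.
by rewrite ffunE.
Qed.

End TProduct.

(** * Discrete Fourier transform of tensors *)

Section Fourier.
Local Open Scope sesquilinear_scope.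
Context {R : realType} {n : nat}.
Local Notation C := R[i].

Lemma cisD (x y : R) : cis (x + y) = cis x * cis y.
Proof.
by apply/eqP; rewrite eq_complex /= cosD sinD; apply/andP; split; apply/eqP; ring.
Qed.

Lemma cis0 : cis 0 = 1 :> C.
Proof. by rewrite /cis cos0 sin0. Qed.

Lemma cis_natmul (x : R) m : cis (m%:R * x) = cis x ^+ m.
Proof.
elim: m => [|m IH]; first by rewrite mul0r cis0.
by rewrite -natr1 mulrDl mul1r cisD IH exprSr.
Qed.

Lemma conj_cis (x : R) : (cis x)^* = cis (- x).
Proof. by rewrite /cis cosN sinN. Qed.

(** Half-angle formula: [cos x = 1 - 2 sin^2 (x/2)] and the sine is positive on
    the open interval from 0 to [pi]. *)
Lemma cis_neq1 (x : R) : 0 < x -> x < 2 * pi -> cis (- x) != 1.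
Proof.
move=> x_gt0 x_lt; rewrite eq_complex negb_and /= cosN; apply/orP; left.
have sin_gt0 : 0 < sin (x / 2) by rewrite sin_gt0_pi //; lra.
have -> : x = (x / 2) *+ 2 by lra.
rewrite cos_mulr2n cos2sin2; apply/eqP; nra.
Qed.

(** For fixed [k] this is a character of the group Z/(n+1) in [j]: its values
    are [n+1]-st roots of unity, so reducing [j] modulo [n+1] does not matter. *)
Definition dft_char (j k : 'I_n.+1) : C := cis (- (2 * pi * j%:R * k%:R / n.+1%:R)).

Lemma dft_charE j k : dft_char j k = cis (- (2 * pi / n.+1%:R)) ^+ (j * k).
Proof. by rewrite -cis_natmul natrM /dft_char; congr cis; ring. Qed.

Lemma root_unity : cis (- (2 * pi / n.+1%:R)) ^+ n.+1 = 1 :> C.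
Proof.
rewrite -cis_natmul mulrN mulrC divfK ?pnatr_eq0 //.
by rewrite /cis cosN sinN mulr_natl cos2pi sin2pi oppr0.
Qed.

Lemma dft_charD j j' k : dft_char (j + j') k = dft_char j k * dft_char j' k.
Proof.
rewrite !dft_charE /= -exprD -mulnDl !(mulnC _ k) !exprM.
by rewrite expr_mod // exprAC root_unity expr1n.
Qed.

Lemma conj_dft_char j k : (dft_char j k)^* = dft_char (- j) k.
Proof.
have w1 : (dft_char j k)^* * dft_char j k = 1 by rewrite conj_cis -cisD addNr cis0.
have w2 : dft_char j k * dft_char (- j) k = 1.
  by rewrite -dft_charD subrr /dft_char mulr0 !mul0r oppr0 cis0.
by rewrite -[LHS]mulr1 -w2 mulrA w1 mul1r.
Qed.

(** Orthogonality of characters: away from [j = 0] this is a geometric sum whose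
    ratio is a nontrivial [n+1]-st root of unity. *)
Lemma sum_dft_char j : \sum_k dft_char j k = if j == 0 then n.+1%:R else 0.
Proof.
have -> : \sum_k dft_char j k = \sum_(k < n.+1) cis (- (2 * pi * j%:R / n.+1%:R)) ^+ k.
  apply: eq_bigr => k _; rewrite -cis_natmul /dft_char; congr cis; ring.
set z := cis _; case: eqP => [j0|/eqP j0].
  have -> : z = 1 by rewrite /z j0 mulr0 mul0r oppr0 cis0.
  by under eq_bigr do rewrite expr1n; rewrite sumr_const card_ord.
have zn : z ^+ n.+1 = 1.
  have -> : z = cis (- (2 * pi / n.+1%:R)) ^+ j.
    by rewrite -cis_natmul; congr cis; ring.
  by rewrite exprAC root_unity expr1n.
have z1 : z != 1.
  have j_gt0 : (0 < j)%N by rewrite lt0n.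
  apply: cis_neq1; first by rewrite !mulr_gt0 ?pi_gt0 ?invr_gt0 ?ltr0n.
  by rewrite ltr_pdivrMr ?ltr0n // ltr_pM2l ?ltr_nat // mulr_gt0 ?pi_gt0.
have /eqP := subrX1 z n.+1; rewrite zn subrr eq_sym mulf_eq0 subr_eq0.
by rewrite (negPf z1) => /eqP.
Qed.

Lemma dftE n1 n2 (A : tensor R n1 n2 n) k : dft A k = \sum_j dft_char j k *: A j.
Proof. by rewrite ffunE. Qed.

(** The t-product is the convolution over Z/(n+1) of frontal slices. *)
Lemma dft_tmul n1 n2 n4 (A : tensor R n1 n2 n) (B : tensor R n2 n4 n) k :
  dft (tmul A B) k = dft A k *m dft B k.
Proof.
rewrite !dftE; under eq_bigr do rewrite tmulE scaler_sumr.
rewrite exchange_big mulmx_sumr; apply: eq_bigr => q _ /=.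
rewrite -scalemxAr mulmx_suml scaler_sumr (reindex_inj (addIr q)) /=.
apply: eq_bigr => r _.
by rewrite addrK dft_charD -scalemxAl scalerA mulrC.
Qed.

Lemma dft_tadj n1 n2 (A : tensor R n1 n2 n) k : dft (tadj A) k = (dft A k) ^t*.
Proof.
rewrite !dftE (reindex_inj oppr_inj) /=; apply/matrixP => a b.
rewrite summxE !mxE summxE rmorph_sum; apply: eq_bigr => j _.
by rewrite !mxE ffunE opprK !mxE -conj_dft_char rmorphM.
Qed.

Lemma dft_tid m k : dft (tid R m n) k = 1%:M.
Proof.
rewrite dftE (bigD1 0) //= big1 => [|j j0].
  by rewrite ffunE eqxx addr0 /dft_char mulr0 !mul0r oppr0 cis0 scale1r.
by rewrite ffunE (negPf j0) scaler0.
Qed.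

Lemma dftD n1 n2 (A B : tensor R n1 n2 n) k : dft (A + B) k = dft A k + dft B k.
Proof.
by rewrite !dftE -big_split; apply: eq_bigr => j _; rewrite taddE scalerDr.
Qed.

Lemma dftB n1 n2 (A B : tensor R n1 n2 n) k : dft (A - B) k = dft A k - dft B k.
Proof.
by rewrite !dftE -sumrB; apply: eq_bigr => j _; rewrite tsubE scalerBr.
Qed.

Lemma row_dft n1 n2 (A : tensor R n1 n2 n) i k :
  row i (dft A k) = dft (hslice A i) k.
Proof.
rewrite !dftE raddf_sum; apply: eq_bigr => j _ /=.
by rewrite ffunE; apply/rowP => b; rewrite !mxE.
Qed.

(** Expanding the squares, the cross terms between distinct slices vanish by
    orthogonality of the characters. *)
Lemma parseval n1 n2 (A : tensor R n1 n2 n) :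
  \sum_k fnorm_sq (dft A k) = n.+1%:R * tnorm A ^+ 2.
Proof.
apply: complexI; rewrite rmorphM rmorph_nat tnorm_sqr !rmorph_sum mulr_sumr /=.
transitivity (\sum_k \sum_j \sum_l dft_char (l - j) k * \tr ((A j) ^t* *m A l)).
  apply: eq_bigr => k _; rewrite fnorm_sq_tr -dft_tadj !dftE mulmx_suml.
  rewrite raddf_sum (reindex_inj oppr_inj); apply: eq_bigr => j _ /=.
  rewrite mulmx_sumr raddf_sum; apply: eq_bigr => l _ /=.
  rewrite -scalemxAl -scalemxAr scalerA linearZ /= ffunE opprK.
  by rewrite addrC dft_charD.
rewrite exchange_big; apply: eq_bigr => j _ /=.
rewrite exchange_big (bigD1 j) //= [X in _ + X]big1 ?addr0 => [|l l_neq].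
  by rewrite -mulr_suml sum_dft_char subrr eqxx fnorm_sq_tr.
by rewrite -mulr_suml sum_dft_char subr_eq0 (negPf l_neq) mul0r.
Qed.

End Fourier.

(** * Mean error of one tensor Kaczmarz step *)

Section KaczmarzStep.
Context {R : realType} {n1 n2 n4 n : nat}.
Implicit Types (A : tensor R n1 n2 n) (B : tensor R n1 n4 n) (X : tensor R n2 n4 n).

Lemma hatrow_sqE A i k : hatrow_sq A i k = fnorm_sq (dft (hslice A i) k).
Proof. by rewrite /hatrow_sq mxnorm_sqr row_dft. Qed.

Lemma sum_hatrow_sq A i : \sum_k hatrow_sq A i k = n.+1%:R * tnorm (hslice A i) ^+ 2.
Proof. by rewrite -parseval; apply: eq_bigr => k _; rewrite hatrow_sqE. Qed.

Lemma hatrow_sq_ge0 A i k : 0 <= hatrow_sq A i k.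
Proof. exact: sqr_ge0. Qed.

Lemma gamma_ge0 A : 0 <= gamma A.
Proof. exact: bigmax_ge_id. Qed.

Lemma hatrow_ratio_le_gamma A i k l : i \in Iplus A ->
  (forall m, 0 < hatrow_sq A i m) ->
  hatrow_sq A i l / hatrow_sq A i k <= gamma A.
Proof.
move=> iA h_gt0; apply: le_trans (le_bigmax_cond _ _ iA); rewrite /gamma_row.
set mx := \big[_/_]_(_ < _) _; set mn := \big[_/_]_(_ < _) _.
have mn_gt0 : 0 < mn by apply/bigmin_gtP; split.
apply: ler_pM; rewrite ?invr_ge0 ?hatrow_sq_ge0 ?le_bigmax //.
by rewrite lef_pV2 ?posrE // bigmin_le.
Qed.

Lemma tinvK m (G : tensor R m m n) : tinvertible G -> tmul (tinv G) G = tid R m n.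
Proof.
by rewrite /tinv; case: pselect => // invG _; case: (cid invG) => H [].
Qed.

(** Since the row of [B] is the row of [A Xs] minus a residual, the step acts on
    the error [X - Xs] alone, driven by the residual of [Xs]. *)
Lemma trk_step_error A B Xs X i :
  trk_step A B i X - Xs =
  (X - Xs) - tmul (tmul (tadj (hslice A i))
                        (tinv (tmul (hslice A i) (tadj (hslice A i)))))
    (tmul (hslice A i) (X - Xs) + hslice (tmul A Xs - B) i).
Proof.
rewrite /trk_step addrAC; congr (_ - tmul _ _).
by rewrite tmulBr hslice_sub hslice_tmul addrA subrK.
Qed.

Lemma trk_step_error_dft A B Xs X i k :
  tinvertible (tmul (hslice A i) (tadj (hslice A i))) ->
  0 < hatrow_sq A i k /\
  fnorm_sq (dft (trk_step A B i X - Xs) k) =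
    fnorm_sq (dft (X - Xs) k)
    - (fnorm_sq (dft (tmul (hslice A i) (X - Xs)) k)
       - fnorm_sq (dft (hslice (tmul A Xs - B) i) k)) / hatrow_sq A i k.
Proof.
move=> /tinvK GK; have := @dft_tid R n 1 k.
rewrite -GK !dft_tmul dft_tadj hatrow_sqE trk_step_error; set E := X - Xs.
rewrite dftB !dft_tmul dftD dft_tmul dft_tadj; apply: fnorm_sq_kaczmarz.
Qed.

(** Both bounds on [p_i / |a_ik|^2] come from
    [p_i = (\sum_l |a_il|^2) / (n3 |A|^2)].  Weighting by [p_i] keeps the
    inequality true for a zero row, whose Gram tensor has no inverse but which
    has probability 0. *)
Lemma trk_step_error_weighted A B Xs X i :
  (i \in Iplus A -> tinvertible (tmul (hslice A i) (tadj (hslice A i)))) ->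
  0 < tnorm A ^+ 2 ->
  row_prob A i * tnorm (trk_step A B i X - Xs) ^+ 2 <=
    row_prob A i * tnorm (X - Xs) ^+ 2
    - tnorm (tmul (hslice A i) (X - Xs)) ^+ 2 / (n.+1%:R * tnorm A ^+ 2)
    + gamma A * tnorm (hslice (tmul A Xs - B) i) ^+ 2 / tnorm A ^+ 2.
Proof.
move=> invA A_gt0; have n_gt0 : 0 < n.+1%:R :> R by rewrite ltr0n.
(* A zero row: the left side and the first two terms of the right side vanish. *)
have [iA|] := boolP (i \in Iplus A); last first.
  rewrite inE -leNgt => ai_le0.
  have ai0 : tnorm (hslice A i) ^+ 2 = 0.
    by apply/eqP; rewrite sqrf_eq0 eq_le ai_le0 sqrtr_ge0.
  have a0 k : hslice A i k = 0.
    apply/eqP; rewrite -fnorm_sq_eq0; move/eqP: ai0; rewrite tnorm_sqr psumr_eq0.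
      by move=> /allP /(_ k (mem_index_enum k)).
    by move=> *; apply: fnorm_sq_ge0.
  have -> : tnorm (tmul (hslice A i) (X - Xs)) ^+ 2 = 0.
    rewrite tnorm_sqr big1 // => k _; apply/eqP; rewrite fnorm_sq_eq0 tmulE big1 //.
    by move=> q _; rewrite a0 mul0mx.
  rewrite /row_prob ai0 !mul0r subrr add0r.
  by rewrite divr_ge0 ?(ltW A_gt0) // mulr_ge0 ?gamma_ge0 ?sqr_ge0.
have step k := trk_step_error_dft B Xs X k (invA iA).
have h_gt0 k : 0 < hatrow_sq A i k by case: (step k).
set p := row_prob A i; set h := hatrow_sq A i in step h_gt0 *.
have pE : p = (\sum_l h l) / (n.+1%:R * tnorm A ^+ 2).
  by rewrite sum_hatrow_sq -mulf_div divff ?mul1r ?pnatr_eq0.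
have p_ge k : (n.+1%:R * tnorm A ^+ 2)^-1 <= p / h k.
  rewrite pE mulrAC -[leLHS]mul1r ler_wpM2r //.
    by rewrite invr_ge0 mulr_ge0 ?(ltW n_gt0) ?(ltW A_gt0).
  rewrite ler_pdivlMr ?mul1r // (bigD1 k) //= lerDl.
  by apply: sumr_ge0 => l _; apply: ltW.
have p_le k : p / h k <= gamma A / tnorm A ^+ 2.
  rewrite pE invfM mulrA mulrAC ler_wpM2r ?invr_ge0 ?(ltW A_gt0) //.
  rewrite mulrAC ler_pdivrMr // mulr_suml.
  rewrite [leRHS]mulr_natr -[n.+1 in leRHS]card_ord -sumr_const.
  by apply: ler_sum => l _; apply: hatrow_ratio_le_gamma.
(* Multiplying by [n3] turns all three norms into sums over frequencies. *)
rewrite -(ler_pM2l n_gt0) mulrCA -(parseval (_ - Xs)) mulr_sumr.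
have -> : n.+1%:R * (p * tnorm (X - Xs) ^+ 2
    - tnorm (tmul (hslice A i) (X - Xs)) ^+ 2 / (n.+1%:R * tnorm A ^+ 2)
    + gamma A * tnorm (hslice (tmul A Xs - B) i) ^+ 2 / tnorm A ^+ 2) =
  \sum_k (p * fnorm_sq (dft (X - Xs) k)
    - (n.+1%:R * tnorm A ^+ 2)^-1 * fnorm_sq (dft (tmul (hslice A i) (X - Xs)) k)
    + gamma A / tnorm A ^+ 2 * fnorm_sq (dft (hslice (tmul A Xs - B) i) k)).
  by rewrite big_split sumrB /= -!mulr_sumr !parseval; ring.
apply: ler_sum => k _; have [_ ->] := step k.
set e := fnorm_sq _; set b := fnorm_sq _; set c := fnorm_sq _.
have -> : p * (e - (b - c) / h k) = p * e - p / h k * b + p / h k * c by ring.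
by rewrite lerD ?lerD2l ?lerN2 ?ler_wpM2r ?fnorm_sq_ge0.
Qed.

(** Excludes a matrix without columns, which has no singular value. *)
Lemma tnorm_gt0_dim A : 0 < tnorm A ^+ 2 -> (0 < n2)%N.
Proof.
case: n2 A => // A; rewrite tnorm_sqr big1 ?ltxx // => k _.
by rewrite /fnorm_sq big1 // => i _; rewrite big_ord0.
Qed.

(** Summing over the rows reassembles [tmul A (X - Xs)] and the residual from
    their row slices; [sigma_min] bounds the former from below. *)
Lemma trk_step_error_mean A B Xs X :
  (forall i, i \in Iplus A -> tinvertible (tmul (hslice A i) (tadj (hslice A i)))) ->
  \rank (bcirc A) = (n.+1 * n2)%N ->
  0 < tnorm A ^+ 2 ->
  \sum_i row_prob A i * tnorm (trk_step A B i X - Xs) ^+ 2 <=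
    (1 - sigma_min (bcirc A) ^+ 2 / (n.+1%:R * tnorm A ^+ 2)) *
      tnorm (X - Xs) ^+ 2
    + gamma A * tnorm (tmul A Xs - B) ^+ 2 / tnorm A ^+ 2.
Proof.
move=> invA rkA A_gt0.
have cols : (\sum_(q < n.+1) n2 = n.+1 * n2)%N by rewrite sum_nat_const card_ord.
have := sigma_min_le (M := bcirc A) (unfold (X - Xs)).
rewrite bcirc_unfold !fnorm_sq_unfold {1}cols muln_gt0 (tnorm_gt0_dim A_gt0).
move=> /(_ isT (etrans rkA (esym cols))) sigma_le.
have row_bound i := trk_step_error_weighted B Xs X (invA i) A_gt0.
apply: le_trans (ler_sum _ (fun i _ => row_bound i)) _.
rewrite big_split sumrB /= -!mulr_suml -mulr_sumr -!tnorm_rows.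
rewrite divff ?gt_eqF // mul1r.
have -> : \sum_i tnorm (tmul (hslice A i) (X - Xs)) ^+ 2 =
    tnorm (tmul A (X - Xs)) ^+ 2.
  by rewrite [RHS]tnorm_rows; apply: eq_bigr => i _; rewrite hslice_tmul.
rewrite mulrBl mul1r lerD2r lerD2l lerN2 mulrAC.
by rewrite ler_wpM2r // invr_ge0 mulr_ge0 ?ler0n ?(ltW A_gt0).
Qed.

End KaczmarzStep.

(** * Expectations along an i.i.d. index sequence *)

Section FiniteExpectation.
Local Open Scope classical_set_scope.
Context d (T : measurableType d) (R : realType) (P : probability T R).

(** A variable with values in a finite type is a finite combination of
    indicators of measurable fibres. *)
Lemma expectation_finite (J : finType) (Y : T -> J) (q g : J -> R) :
  (forall y, measurable (Y @^-1` [set y])) ->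
  (forall y, P (Y @^-1` [set y]) = (q y)%:E) ->
  (forall y, 0 <= g y) ->
  ('E_P[fun w => g (Y w)] = (\sum_y q y * g y)%:E)%E.
Proof.
move=> mY PY g_ge0; rewrite unlock.
transitivity (\int[P]_w (\sum_(y <- index_enum J)
    ((g y)%:E * (\1_(Y @^-1` [set y]) w)%:E)))%E.
  apply: eq_integral => w _; rewrite (bigD1 (Y w)) //= [X in (_ + X)%E]big1.
    by rewrite adde0 indicE mem_set // mule1.
  by move=> y /eqP yY; rewrite indicE memNset ?mule0 // => /esym.
rewrite ge0_integral_sum //.
- rewrite -sumEFin; apply: eq_bigr => y _.
  rewrite ge0_integralZl_EFin //.
  + by rewrite integral_indic // setIT [X in (_ * X)%E]PY -EFinM mulrC.
  + apply/measurable_EFinP; exact: measurable_indic.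
- move=> y; apply: measurable_funeM.
  by apply/measurable_EFinP; exact: measurable_indic.
- by move=> y w _; rewrite mule_ge0 // lee_fin.
Qed.

End FiniteExpectation.

Section IidSequence.
Local Open Scope classical_set_scope.
Context d (T : measurableType d) (R : realType) (P : probability T R).
Context (I : finType) (p : I -> R) (X : nat -> T -> I).
Context (iidX : iid_with_law P p X).

Lemma iid_law_sum : \sum_i p i = 1.
Proof.
have [mX PX _] := iidX.
have := expectation_finite (mX 0) (PX 0) (fun=> ler01).
rewrite expectation_cst => -[sum1]; rewrite [RHS]sum1.
by apply: eq_bigr => i _; rewrite mulr1.
Qed.

Lemma iid_law_ge0 i : 0 <= p i.
Proof. by have [_ PX _] := iidX; rewrite -lee_fin -(PX 0%N) measure_ge0. Qed.

(** Product rule over the times [iota 0 t] with singleton events. *)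
Lemma iid_cylinder (h : nat -> I) t :
  P [set w | forall s, (s < t)%N -> X s w = h s] = (\prod_(s < t) p (h s))%:E.
Proof.
have [_ PX indX] := iidX.
have -> : [set w | forall s, (s < t)%N -> X s w = h s] =
    \bigcap_(s in [set` iota 0 t]) (X s @^-1` [set h s]).
  by apply/seteqP; split => w /= Hw s; have := Hw s; rewrite /= mem_iota.
rewrite (indX _ (fun s => [set h s])) ?iota_uniq // -prodEFin.
rewrite -(big_mkord xpredT (fun s => (p (h s))%:E)) /index_iota subn0.
by apply: eq_bigr => s _; rewrite PX.
Qed.

Lemma iid_cylinder_measurable (h : nat -> I) t :
  measurable [set w | forall s, (s < t)%N -> X s w = h s].
Proof.
have [mX _ _] := iidX.
have -> : [set w | forall s, (s < t)%N -> X s w = h s] =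
    \bigcap_(s in [set` iota 0 t]) (X s @^-1` [set h s]).
  by apply/seteqP; split => w /= Hw s; have := Hw s; rewrite /= mem_iota.
apply: fin_bigcap_measurable; first exact: finite_seq.
by move=> s _; exact: mX.
Qed.

(** Completes a history of length [t] to a sequence; the values from time [t] on
    are arbitrary, and those of [X] at the base point of the sample space are
    used because the index type has no distinguished element. *)
Definition extend t (h : {ffun 'I_t -> I}) (s : nat) : I :=
  if insub s is Some s' then h s' else X s point.

Lemma extend_ord t (h : {ffun 'I_t -> I}) (s : 'I_t) : extend h s = h s.
Proof. by rewrite /extend insubT // => lt_s; congr (h _); apply: val_inj. Qed.

(** The history before time [t] and the index drawn at time [t] form a single
    finite variable, whose law factors by independence. *)
Lemma iid_expectation t (G : (nat -> I) -> I -> R) :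
  (forall h i, 0 <= G h i) ->
  (forall h h' i, (forall s, (s < t)%N -> h s = h' s) -> G h i = G h' i) ->
  ('E_P[fun w => G (X^~ w) (X t w)] =
   (\sum_(h : {ffun 'I_t -> I})
      (\prod_(s < t) p (h s)) * \sum_i p i * G (extend h) i)%:E)%E.
Proof.
move=> G_ge0 G_past.
pose Y w : {ffun 'I_t -> I} * I := ([ffun s : 'I_t => X s w], X t w).
(* The first [t.+1] values of the sequence that a pair (history, index) encodes. *)
pose upd (y : {ffun 'I_t -> I} * I) s := if (s < t)%N then extend y.1 s else y.2.
have preY y : Y @^-1` [set y] = [set w | forall s, (s < t.+1)%N -> X s w = upd y s].
  apply/seteqP; split => w /=.
    move=> <- s; rewrite ltnS leq_eqVlt /upd => /orP[/eqP ->|lt_st].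
      by rewrite ltnn.
    by rewrite lt_st -[s]/(val (Ordinal lt_st)) extend_ord ffunE.
  move=> Xy; rewrite (surjective_pairing y) /Y; congr pair.
    apply/ffunP => s; rewrite ffunE Xy ?ltnS 1?ltnW // /upd ltn_ord.
    by rewrite extend_ord.
  by rewrite Xy // /upd ltnn.
pose q (y : {ffun 'I_t -> I} * I) := (\prod_(s < t) p (y.1 s)) * p y.2.
have PY y : P (Y @^-1` [set y]) = (q y)%:E.
  rewrite preY iid_cylinder big_ord_recr /q /upd /= ltnn; congr (_ * _)%:E.
  by apply: eq_bigr => s _; rewrite ltn_ord extend_ord.
have mY y : measurable (Y @^-1` [set y]).
  by rewrite preY; exact: iid_cylinder_measurable.
pose g (y : {ffun 'I_t -> I} * I) := G (extend y.1) y.2.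
transitivity ('E_P[fun w => g (Y w)])%E.
  congr expectation; apply/funext => w; apply: G_past => s lt_st.
  by rewrite -[s]/(val (Ordinal lt_st)) extend_ord ffunE.
rewrite (expectation_finite mY PY) => [|y]; last exact: G_ge0.
congr EFin; rewrite /q /g.
rewrite -(pair_bigA _ (fun (h : {ffun 'I_t -> I}) i =>
  (\prod_(s < t) p (h s)) * p i * G (extend h) i)) /=.
by apply: eq_bigr => h _; rewrite mulr_sumr; apply: eq_bigr => i _; rewrite mulrA.
Qed.

Lemma iid_history_sum t : \sum_(h : {ffun 'I_t -> I}) \prod_(s < t) p (h s) = 1.
Proof.
rewrite -(bigA_distr_bigA (fun _ => p)).
by rewrite big1 // => s _; rewrite iid_law_sum.
Qed.

(** Averaging a one-step inequality that holds conditionally on the past.  The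
    expectations on both sides are sums over the same histories of length [t]
    with the same product weights, so it suffices to compare them term by term. *)
Lemma iid_mean_recursion t (G : (nat -> I) -> I -> R) (f : (nat -> I) -> R) (a b : R) :
  (forall h i, 0 <= G h i) -> (forall h, 0 <= f h) ->
  (forall h h', (forall s, (s < t)%N -> h s = h' s) ->
     G h = G h' /\ f h = f h') ->
  (forall h, \sum_i p i * G h i <= a * f h + b) ->
  ('E_P[fun w => G (X^~ w) (X t w)] <= a%:E * 'E_P[fun w => f (X^~ w)] + b%:E)%E.
Proof.
move=> G_ge0 f_ge0 past step.
have EG := iid_expectation (t := t) G_ge0
  (fun h h' i hh' => congr1 (@^~ i) (past h h' hh').1).
have Ef := iid_expectation (t := t) (G := fun h _ => f h) (fun h _ => f_ge0 h)
  (fun h h' _ hh' => (past h h' hh').2).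
rewrite EG Ef -EFinM -EFinD lee_fin.
under [X in _ <= _ * X + _]eq_bigr do rewrite -mulr_suml iid_law_sum mul1r.
have -> : b = \sum_(h : {ffun 'I_t -> I}) (\prod_(s < t) p (h s)) * b.
  by rewrite -mulr_suml iid_history_sum mul1r.
rewrite mulr_sumr -big_split /=.
apply: ler_sum => h _; rewrite mulrCA -mulrDr ler_wpM2l //.
by apply: prodr_ge0 => s _; exact: iid_law_ge0.
Qed.

End IidSequence.

(** * The recursion for the Kaczmarz iterates *)

Lemma trk_eq_prefix (R : realType) n1 n2 n4 n (A : tensor R n1 n2 n)
    (B : tensor R n1 n4 n) X0 (h h' : nat -> 'I_n1) t :
  (forall s, (s < t)%N -> h s = h' s) -> trk A B X0 h t = trk A B X0 h' t.
Proof.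
elim: t => [//|t IH] hh'.
have IHt := IH (fun s lt_st => hh' s (ltnW lt_st)).
by rewrite [LHS]/= [RHS]/= IHt (hh' t (ltnSn t)).
Qed.

Theorem theorem3p3 (R : realType) (n1 n2 n4 n : nat)
  (A EA : tensor R n1 n2 n) (Xstar : tensor R n2 n4 n) (B EB : tensor R n1 n4 n)
  (X0 : tensor R n2 n4 n)
  (d : measure_display) (T : measurableType d) (P : probability T R)
  (idx : nat -> T -> 'I_n1) :
  let n3 := n.+1 in
  let At := A + EA in
  let Bt := B + EB in
  let X (t : nat) (w : T) := trk At Bt X0 (fun s => idx s w) t in
  let err (t : nat) (w : T) : R := tnorm (X t w - Xstar) ^+ 2 in
  tmul A Xstar = B ->
  (forall i, i \in Iplus At ->
     tinvertible (tmul (hslice At i) (tadj (hslice At i)))) ->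
  \rank (bcirc At) = (n3 * n2)%N ->
  iid_with_law P (row_prob At) idx ->
  forall t : nat,
    ('E_P[err t.+1] <=
       (1 - sigma_min (bcirc At) ^+ 2 / (n3%:R * tnorm At ^+ 2))%:E * 'E_P[err t]
       + (gamma At * tnorm (tmul EA Xstar - EB) ^+ 2 / tnorm At ^+ 2)%:E)%E.
Proof.
move=> n3 At Bt X err AX invA rkA iid t.
(* For the zero tensor all the row probabilities are 0 and cannot sum to 1. *)
have A_gt0 : 0 < tnorm At ^+ 2.
  rewrite lt_neqAle sqr_ge0 andbT; apply/eqP => A0.
  have := iid_law_sum iid; rewrite big1 => [/esym/eqP|i _].
    by rewrite oner_eq0.
  by rewrite /row_prob -A0 invr0 mulr0.
have residual : tmul At Xstar - Bt = tmul EA Xstar - EB.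
  by rewrite tmulDl AX opprD addrACA subrr add0r.
pose f (h : nat -> 'I_n1) := tnorm (trk At Bt X0 h t - Xstar) ^+ 2.
pose G (h : nat -> 'I_n1) i :=
  tnorm (trk_step At Bt i (trk At Bt X0 h t) - Xstar) ^+ 2.
apply: (iid_mean_recursion iid (G := G) (f := f)).
- by move=> h i; exact: sqr_ge0.
- by move=> h; exact: sqr_ge0.
- by move=> h h' /trk_eq_prefix hh'; rewrite /G /f hh'.
- by move=> h; rewrite -residual; exact: trk_step_error_mean.
Qed.
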